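(* Let $Q$ be a countable better quasi-order. If $Q$ is thin, then $[Q]^{<\omega}$ ordered by $\leqq_m$ is thin, and the class $\mathcal{FT}_Q$ of finite $Q$-labeled trees ordered by $\leqq_m$ is thin.
   Context: A quasi-order is a set (or class) $Q$ with a reflexive transitive relation $\leqq_Q$. $[\omega]^\omega$ is the set of infinite subsets of $\omega$, identified with strictly increasing sequences and topologized as a subspace of $\omega^\omega$; for infinite $A\subseteq\omega$, $[A]^\omega$ is the set of infinite subsets of $A$. A quasi-order $Q$ is a better quasi-order (BQO) if, giving $Q$ the discrete topology, for every Borel map $f:[\omega]^\omega\to Q$ there is $A\in[\omega]^\omega$ such that $f(B)\leqq_Q f(B\setminus\{\min B\})$ for all $B\in[A]^\omega$. A Borel graph is a pair $(V,E)$ with $V$ Polish and $E\subseteq[V]^2$ Borel. Its Borel chromatic number $\chi_B$ is the least cardinality $|Y|$ of a Polish space $Y$ for which there is a Borel map $V\to Y$ sending adjacent vertices to distinct points. For a countable BQO $Q$, let $\vec Q=\{X\in Q^\omega:\forall k\in\omega,\ X(k)\not\leqq_Q X(k+1)\}$ (subspace of $Q^\omega$ with the product of discrete topologies), regarded as a Borel graph in which distinct $X,Y$ are adjacent iff $S(X)=Y$ or $S(Y)=X$, where $S(X)(k)=X(k+1)$. A countable BQO $Q$ is thin if $\chi_B(\vec Q)\leq 3$. A BQO (set or class) that is not assumed countable is called thin if every countably infinite subset of it, with the induced order, is thin. $[Q]^{<\omega}$ is the set of finite subsets of $Q$, with $a\leqq_m b$ iff there is a function $f:a\to b$ with $q\leqq_Q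 f(q)$ for all $q\in a$. A tree is a partial order $(T,\leq_T)$ such that for each $t\in T$ the set $\{v\in T:v\leq_T t\}$ is well ordered by $\leq_T$, and $T$ has a $\leq_T$-least element (the root). $\mathcal{FT}_Q$ is the class of pairs $(T,l)$ with $T$ a finite tree and $l:T\to Q$. The order $\leqq_m$ on $\mathcal{FT}_Q$: $(T_1,l_1)\leqq_m(T_2,l_2)$ iff there is $f:T_1\to T_2$ such that for all $x,y\in T_1$, $x\leq_{T_1}y$ implies $f(x)\leq_{T_2}f(y)$, and $l_1(x)\leqq_Q l_2(f(x))$ for all $x\in T_1$. *)

(* Defs.v *)
From HB Require Import structures.
From mathcomp Require Import all_boot all_order all_algebra finmap.
From mathcomp Require Import all_classical all_reals topology.
From mathcomp Require Import measurable_structure.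
From Stdlib Require Relation_Definitions.

Set Implicit Arguments.
Unset Strict Implicit.
Unset Printing Implicit Defensive.

Import Order.TTheory GRing.Theory Num.Theory.
Local Open Scope classical_set_scope.
Local Open Scope ring_scope.

Definition quasi_order (Q : Type) (le : Q -> Q -> Prop) : Prop :=
  Relation_Definitions.preorder Q le.

(* The measurable types of the library are pointed, whereas the spaces below
   may be empty; hence the direct use of the generated sigma-algebra. *)
Definition borel (T : topologicalType) : set (set T) := <<s @open T >>.

Definition borel_map (T U : topologicalType) (f : T -> U) : Prop :=
  forall B : set U, borel B -> borel (f @^-1` B).

Definition compatible_complete_metric (R : realType) (T : topologicalType)
    (d : T -> T -> R) : Prop :=
  [/\ forall x y, d x y = 0 <-> x = y,
      forall x y, d x y = d y x,
      forall x y z, d x z <= d x y + d y z,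
      forall (x : T) (A : set T),
        nbhs x A <-> exists2 e : R, 0 < e & [set y | d x y < e] `<=` A
    & forall u : nat -> T,
        (forall e : R, 0 < e -> exists N : nat, forall m n : nat,
           (N <= m)%N -> (N <= n)%N -> d (u m) (u n) < e) ->
        exists l : T, u @ \oo --> l].

Definition polish (R : realType) (T : topologicalType) : Prop :=
  (exists2 D : set T, countable D & dense D) /\
  (exists d : T -> T -> R, compatible_complete_metric d).

Definition borel_colorable (V : topologicalType) (E : V -> V -> Prop)
    (Y : topologicalType) : Prop :=
  exists2 c : V -> Y, borel_map c & forall x y, E x y -> c x <> c y.

(* [[set: Y]] has the cardinality of the Borel chromatic number of [(V, E)]. *)
Definition is_borel_chromatic_number (R : realType) (V : topologicalType)
    (E : V -> V -> Prop) (Y : topologicalType) : Prop :=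
  [/\ polish R Y, borel_colorable E Y &
      forall Z : topologicalType, polish R Z -> borel_colorable E Z ->
        ([set: Y] #<= [set: Z])%card].

Definition borel_chromatic_number_le (R : realType) (V : topologicalType)
    (E : V -> V -> Prop) (n : nat) : Prop :=
  exists2 Y : topologicalType, is_borel_chromatic_number R E Y &
    ([set: Y] #<= `I_n)%card.

(* The space of infinite subsets of [nat]: an infinite set is represented by
   its strictly increasing enumeration, and [set_type] carries the topology
   induced from the product topology. *)
Definition inf_subsets : set {ptws nat -> nat} :=
  [set s | {homo s : m n / (m < n)%N}].

Definition elements (B : inf_subsets) : set nat := range (val B).

Definition shift (T : Type) (X : nat -> T) : nat -> T := fun k => X k.+1.

Lemma shift_inf_subsets (B : inf_subsets) : shift (val B) \in inf_subsets.
Proof.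
by apply/mem_set => m n mn /=; have /set_mem := valP B; apply; rewrite ltnS.
Qed.

Definition remove_min (B : inf_subsets) : inf_subsets :=
  exist _ (shift (val B)) (shift_inf_subsets B).

Lemma elements_remove_min (B : inf_subsets) :
  elements (remove_min B) = elements B `\ val B 0%N.
Proof.
have incB : {homo val B : m n / (m < n)%N} by have /set_mem := valP B.
apply/seteqP; split=> [_ [k _ <-]|_ [[[|k] _ <-] nk]].
- split; first by exists k.+1.
  by move=> e; have := incB 0%N k.+1 isT; rewrite -[X in (X < _)%N]e ltnn.
- by case: nk.
- by exists k.
Qed.

Definition bqo (Q : choiceType) (le : Q -> Q -> Prop) : Prop :=
  quasi_order le /\
  forall f : inf_subsets -> discrete_topology Q, borel_map f ->
    exists A : inf_subsets, forall B : inf_subsets,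
      elements B `<=` elements A -> le (f B) (f (remove_min B)).

Definition countable_bqo (Q : choiceType) (le : Q -> Q -> Prop) : Prop :=
  countable [set: Q] /\ bqo le.

Definition vec (Q : choiceType) (le : Q -> Q -> Prop) :
    set {ptws nat -> discrete_topology Q} :=
  [set X | forall k, ~ le (X k) (X k.+1)].

Definition vec_adj (Q : choiceType) (le : Q -> Q -> Prop)
    (X Y : vec le) : Prop :=
  X <> Y /\ (shift (val X) = val Y \/ shift (val Y) = val X).

Definition countable_thin (R : realType) (Q : choiceType)
    (le : Q -> Q -> Prop) : Prop :=
  countable_bqo le /\ borel_chromatic_number_le R (@vec_adj Q le) 3.

Definition induced (Q : Type) (le : Q -> Q -> Prop) (A : set Q) :
  A -> A -> Prop := fun x y => le (val x) (val y).

Definition thin (R : realType) (Q : choiceType) (le : Q -> Q -> Prop) : Prop :=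
  bqo le /\
  forall A : set Q, (A #= [set: nat])%card ->
    countable_thin R (@induced Q le A).

Definition fset_le (Q : choiceType) (le : Q -> Q -> Prop)
    (a b : {fset Q}) : Prop :=
  exists f : a -> b, forall q : a, le (val q) (val (f q)).

(* For [leT] a partial order this says that [leT] well orders [A]; totality on
   [A] is the case of two-element [S]. *)
Definition well_ordered (T : Type) (leT : T -> T -> Prop) (A : set T) : Prop :=
  forall S : set T, S `<=` A -> S !=set0 ->
    exists2 m, S m & forall s, S s -> leT m s.

Definition is_tree (T : Type) (leT : T -> T -> Prop) : Prop :=
  [/\ Relation_Definitions.order T leT,
      forall t : T, well_ordered leT [set v | leT v t]
    & exists r : T, forall t : T, leT r t].

(* The carrier is an arbitrary finite type rather than a [finType], because the
   universe of [finType] is too large for this record to be a [choiceType]. *)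
Record labeled_tree (Q : Type) := LabeledTree {
  node : Type;
  tree_le : node -> node -> Prop;
  label : node -> Q;
  node_finite : finite_set [set: node];
  tree_leP : is_tree tree_le
}.

HB.instance Definition _ (Q : Type) := gen_eqMixin (labeled_tree Q).
HB.instance Definition _ (Q : Type) := gen_choiceMixin (labeled_tree Q).

Definition labeled_tree_le (Q : Type) (le : Q -> Q -> Prop)
    (T1 T2 : labeled_tree Q) : Prop :=
  exists f : node T1 -> node T2,
    (forall x y, tree_le x y -> tree_le (f x) (f y)) /\
    (forall x, le (label x) (label (f x))).

(* Main.v *)
Require Import Defs.
From mathcomp Require Import all_boot all_order all_algebra finmap.
From mathcomp Require Import all_classical all_reals topology.
From mathcomp Require Import measurable_structure.

(** Both parts come from one reduction.  Let [P] be a countable quasi-order and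
let [psi] be a Borel map from the sequences over [P] that are bad at every step
to [Q], such that [psi X] is never below [psi] of the shift of [X].  Iterating
[psi] along the shift turns [X] into the sequence
[psi X, psi (shift X), psi (shift (shift X)), ...], which is bad over [Q], and
this transformation commutes with the shift.  Two consequences follow.

- A Borel colouring of the bad sequences over [Q] pulls back to the bad
  sequences over [P].  Adjacent sequences keep distinct images, because a bad
  sequence over a reflexive relation is never fixed by the shift
  ([reduction_chromatic]).
- [P] is a better quasi-order ([reduction_bqo]).  Given a Borel [f], the set of
  those [B] with [f B] below [f (remove_min B)] is Borel, so the Galvin-Prikry
  theorem [galvin_prikry] makes it homogeneous on some infinite set.  If
  badness were the homogeneous case, following [f] along successive removals of
  the minimum and applying [psi] would give a Borel map into [Q] which is bad
  everywhere.

For finite sets, [psi X] is an element of [X 0] below no element of [X 1].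
Such an element is by choice not below the one chosen in [X 1].

For finite trees, suppose [T1] does not map to [T2] although the root label of
[T1] is below that of [T2].  Then some proper subtree of [T1] already does not
map to [T2]: otherwise the maps defined on the branches could be glued along
the roots ([labeled_tree_le_subtrees]).  Starting from a bad sequence of trees,
perform this replacement simultaneously at all positions where consecutive root
labels are comparable, and repeat.  Replacing [T2] by a subtree of itself only
makes it harder to map into, so the sequence stays bad.  Trees at a given
position get strictly smaller whenever they change, so each position
stabilises, and in the limit no root label is below the next one.  The limit
root label at position [0] is [psi X]; it is a pointwise limit of maps that
depend on finitely many entries, hence Borel.
The class of all finite trees is not countable as a type, but a tree is
determined up to equivalence by a finite code ([code_le]), and this reduces the
better-quasi-order property to a countable family of trees.

The Galvin-Prikry theorem is proved by the method of Ellentuck: sets all of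
whose sections have the Ramsey property form a sigma-algebra containing the
open sets. *)

Set Implicit Arguments.
Unset Strict Implicit.
Unset Printing Implicit Defensive.

Local Open Scope classical_set_scope.

(** * Increasing sequences of natural numbers *)

Definition increasing (X : nat -> nat) : Prop :=
  {homo X : m n / (m < n)%N}.

Definition tail (T : Type) (n : nat) (X : nat -> T) : nat -> T :=
  fun k => X (n + k)%N.

Definition prepend (a : seq nat) (X : nat -> nat) : nat -> nat :=
  fun k => if (k < size a)%N then nth 0%N a k else X (k - size a)%N.

(** No relation between [a] and the first term of [X] is required, so that
taking sections preserves open sets and composes without side conditions. *)
Definition section (a : seq nat) (C : set (nat -> nat)) : set (nat -> nat) :=
  [set X | C (prepend a X)].

Lemma increasing_lt X m n : increasing X -> (X m < X n)%N = (m < n)%N.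
Proof. by move=> incX; apply: leqW_mono; apply: leq_mono. Qed.

Lemma increasing_step X : (forall n, (X n < X n.+1)%N) -> increasing X.
Proof. by move=> h; apply: homo_ltn => //; exact: ltn_trans. Qed.

Lemma increasing_tail n X : increasing X -> increasing (tail n X).
Proof. by move=> incX i j ij; apply: incX; rewrite ltn_add2l. Qed.

Lemma range_tail T n (X : nat -> T) : range (tail n X) `<=` range X.
Proof. by move=> _ [k _ <-]; exists (n + k)%N. Qed.

Lemma range_tail_le T m n (X : nat -> T) :
  (m <= n)%N -> range (tail n X) `<=` range (tail m X).
Proof.
by move=> mn _ [k _ <-]; exists (n - m + k)%N => //; rewrite /tail addnA subnKC.
Qed.

Lemma prepend_nil X : prepend [::] X = X.
Proof. by apply/funext => k; rewrite /prepend subn0. Qed.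

Lemma prepend_cat a b X : prepend (a ++ b) X = prepend a (prepend b X).
Proof.
apply/funext => k; rewrite /prepend size_cat nth_cat.
have [ka|ak] := ltnP k (size a); first by rewrite ltn_addr.
by rewrite -ltn_subLR // subnDA.
Qed.

Lemma prepend_mkseq X m : prepend (mkseq X m) (tail m X) = X.
Proof.
apply/funext => k; rewrite /prepend /tail size_mkseq.
by have [km|mk] := ltnP k m; [rewrite nth_mkseq | rewrite subnKC].
Qed.

Lemma section_cat a b C : section b (section a C) = section (a ++ b) C.
Proof. by apply/seteqP; split=> X; rewrite /section /= prepend_cat. Qed.

(** An infinite subset [D] of [B] meeting [B] at [D m = B n] splits there: what
precedes lies in the first [n] elements of [B], what follows in the rest.  This
is how an initial segment of [D] is recognised among those handled at stage
[n] of a fusion. *)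
Lemma subseq_mkseq_range D B m n : increasing D -> increasing B ->
    range D `<=` range B -> D m = B n ->
  subseq (mkseq D m) (mkseq B n) /\ range (tail m D) `<=` range (tail n B).
Proof.
move=> incD incB DB Dm; split; last first.
  move=> _ [k _ <-]; have [j _ Bj] := DB _ (imageT D (m + k)%N).
  exists (j - n)%N => //; rewrite /tail subnKC // leqNgt.
  rewrite -(increasing_lt _ _ incB) Bj -Dm increasing_lt //.
  by rewrite -leqNgt leq_addr.
have sorted_mk X l : increasing X -> sorted ltn (mkseq X l).
  move=> incX; rewrite sorted_map; apply: sub_sorted (iota_ltn_sorted 0 l).
  by move=> i j; apply: incX.
suff -> : mkseq D m = [seq x <- mkseq B n | x \in mkseq D m].
  exact: filter_subseq.
apply: (irr_sorted_eq ltn_trans ltnn).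
- exact: sorted_mk.
- by apply: sorted_filter; [exact: ltn_trans | exact: sorted_mk].
move=> x; rewrite mem_filter; apply/idP/andP => [xD|[]//]; split=> //.
have /mapP[i] := xD; rewrite mem_iota /= add0n => im Dx.
have [j _ Bj] := DB _ (imageT D i).
rewrite Dx -Bj; apply: map_f; rewrite mem_iota /= add0n.
by rewrite -(increasing_lt _ _ incB) Bj -Dm increasing_lt.
Qed.

Lemma increasing_inj X : increasing X -> injective X.
Proof. by move=> incX; exact: (incn_inj (leq_mono incX)). Qed.

Lemma range_tail_sub n X Y : increasing X -> increasing Y ->
  range Y `<=` range X -> range (tail n Y) `<=` range (tail n X).
Proof.
move=> incX incY YX; have index_ge m : forall j, X j = Y m -> (m <= j)%N.
  elim: m => [//|m IH] j Xj; have [i _ Xi] := YX _ (imageT Y m).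
  apply: leq_ltn_trans (IH _ Xi) _.
  by rewrite -(increasing_lt _ _ incX) Xi Xj incY.
move=> _ [k _ <-]; have [j _ Xj] := YX _ (imageT Y (n + k)%N).
have nj : (n <= j)%N by apply: leq_trans (index_ge _ _ Xj); exact: leq_addr.
by exists (j - n)%N => //; rewrite /tail subnKC.
Qed.

Lemma infinite_increasing (Z : set nat) :
  (forall N, exists2 n, (N <= n)%N & Z n) ->
  exists2 e, increasing e & forall k, Z (e k).
Proof.
move=> Zinf; have /choice[h hP] N : exists n, (N <= n)%N /\ Z n.
  by have [n] := Zinf N; exists n.
exists (fun k => iter k (h \o succn) (h 0%N)).
  by apply: increasing_step => n; have [] := hP (iter n (h \o succn) (h 0%N)).+1.
case=> [|k] /=; first by have [] := hP 0%N.
by have [] := hP (iter k (h \o succn) (h 0%N)).+1.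
Qed.

(** * Fusion *)

Section Fusion.
Variable R : seq nat -> (nat -> nat) -> Prop.
Hypothesis R_sub : forall a X Y, increasing Y -> range Y `<=` range X ->
  R a X -> R a Y.
Hypothesis R_dense : forall a X, increasing X ->
  exists Y, [/\ increasing Y, range Y `<=` range X & R a Y].

Lemma dense_list (l : seq (seq nat)) X : increasing X ->
  exists Y, [/\ increasing Y, range Y `<=` range X & {in l, forall a, R a Y}].
Proof.
move=> incX; elim: l => [|a l [Y [incY YX RY]]]; first by exists X; split.
have [Z [incZ ZY RZ]] := R_dense a incY; exists Z; split=> //.
  exact: subset_trans YX.
move=> b; rewrite inE => /predU1P[->//|bl].
by apply: R_sub incZ ZY _; exact: RY.
Qed.

(** Build [Y] one element at a time.  Having chosen finitely many elements,
shrink the reservoir so that [R] holds for every subsequence of them, which are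
finitely many requirements, and take the least element of the new reservoir as
the next element of [Y].  All later elements come from that reservoir. *)
Lemma fusion X : increasing X ->
  exists Y, [/\ increasing Y, range Y `<=` range X &
    forall n a, subseq a (mkseq Y n) -> R a (tail n Y)].
Proof.
move=> incX.
pose subseqs (b : seq nat) := codom (fun m : (size b).-tuple bool => mask m b).
have /choice[next nextP] (p : seq nat * (nat -> nat)) : exists Y,
    increasing p.2 -> [/\ increasing Y,
      range Y `<=` range p.2 & {in subseqs p.1, forall a, R a Y}].
  case: p => b A; have [incA|nincA] := pselect (increasing A).
    by have [Y YP] := dense_list (subseqs b) incA; exists Y.
  by exists A.
(* A state is the list of elements chosen so far and the current reservoir. *)
pose step p := (rcons p.1 (next p 0%N), tail 1 (next p)).
pose st n := iter n step ([::], X).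
have inc_st n : increasing (st n).2.
  elim: n => [//|n IH]; rewrite /st /=; apply: increasing_tail.
  by have [] := nextP _ IH.
pose A n := next (st n); pose Y n := A n 0%N.
have incA n : increasing (A n) by have [] := nextP _ (inc_st n).
have rangeA n : range (A n.+1) `<=` range (tail 1 (A n)).
  by have [_ + _] := nextP _ (inc_st n.+1).
have rangeA_le n k : range (A (n + k)%N) `<=` range (A n).
  elim: k => [|k IH]; first by rewrite addn0.
  rewrite addnS; apply: subset_trans IH; apply: subset_trans (rangeA _) _.
  exact: range_tail.
have st1 n : (st n).1 = mkseq Y n.
  by elim: n => [//|n IH]; rewrite mkseqS -IH.
have rangeY n : range (tail n Y) `<=` range (A n).
  by move=> _ [k _ <-]; apply: (rangeA_le n k); exists 0%N.
have incY : increasing Y.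
  apply: increasing_step => n; have [k _ e] := rangeA n _ (imageT _ 0%N).
  by rewrite /Y -e /tail; apply: incA.
exists Y; split=> // [|n a aY].
  move=> _ [k _ <-]; have [_ h _] := nextP _ (inc_st 0%N).
  by apply: h; apply: (rangeA_le 0%N k); exists 0%N.
have [_ _ RA] := nextP _ (inc_st n).
apply: R_sub (rangeY n) _; first exact: increasing_tail.
apply: RA; rewrite st1; have /subseqP[m /eqP sm ->] := aY.
exact: (codom_f (fun m : (size (mkseq Y n)).-tuple bool => mask m _) (Tuple sm)).
Qed.

End Fusion.

(** * Completely Ramsey sets *)

Definition homogeneous (C : set (nat -> nat)) (Y : nat -> nat) : Prop :=
  (forall D, increasing D -> range D `<=` range Y -> C D) \/
  (forall D, increasing D -> range D `<=` range Y -> ~ C D).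

Definition ramsey (C : set (nat -> nat)) : Prop :=
  forall X, increasing X ->
    exists Y, [/\ increasing Y, range Y `<=` range X & homogeneous C Y].

Definition completely_ramsey (C : set (nat -> nat)) : Prop :=
  forall a, ramsey (section a C).

Lemma homogeneous_sub C X Y : range Y `<=` range X ->
  homogeneous C X -> homogeneous C Y.
Proof.
by move=> YX [h|h]; [left|right] => D incD DY; apply: h => //;
  exact: subset_trans YX.
Qed.

Definition seq_open (C : set (nat -> nat)) : Prop :=
  forall X, C X -> exists n, forall Y, mkseq Y n = mkseq X n -> C Y.

Section OpenRamsey.
Variable C : set (nat -> nat).
Hypothesis openC : seq_open C.

Let accepts a (Y : nat -> nat) :=
  forall D, increasing D -> range D `<=` range Y ->
  C (prepend a D).

Let rejects a (Y : nat -> nat) :=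
  forall Z, increasing Z -> range Z `<=` range Y ->
  ~ accepts a Z.

Let decides a (Y : nat -> nat) := accepts a Y \/ rejects a Y.

(* Rejection has to propagate to one-point extensions; [settles] asks for this
   within a single set, so that it can be fed to the fusion lemma. *)
Let settles a (Y : nat -> nat) :=
  accepts a Y \/ rejects a Y /\ forall k, rejects (rcons a (Y k)) Y.

Let accepts_sub a X Y : range Y `<=` range X -> accepts a X -> accepts a Y.
Proof. by move=> YX aX D incD DY; apply: aX => //; exact: subset_trans YX. Qed.

Let rejects_sub a X Y : range Y `<=` range X -> rejects a X -> rejects a Y.
Proof. by move=> YX aX D incD DY; apply: aX => //; exact: subset_trans YX. Qed.

(* Acceptance is inherited by subsets, hence rejection depends only on the
   eventual part of a set. *)
Let rejects_tail a n X : increasing X -> rejects a (tail n X) -> rejects a X.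
Proof.
move=> incX rej Z incZ ZX aZ; apply: (rej (tail n Z)).
- exact: increasing_tail.
- exact: range_tail_sub.
- by apply: accepts_sub aZ; exact: range_tail.
Qed.

Let decides_dense a X : increasing X ->
  exists Y, [/\ increasing Y, range Y `<=` range X & decides a Y].
Proof.
move=> incX; have [[Y [incY YX aY]]|none] := pselect
  (exists Y, [/\ increasing Y, range Y `<=` range X & accepts a Y]).
  by exists Y; split=> //; left.
by exists X; split=> //; right => Z incZ ZX aZ; apply: none; exists Z.
Qed.

Let decides_sub a X Y : range Y `<=` range X -> decides a X -> decides a Y.
Proof.
by move=> YX [h|h]; [left; exact: accepts_sub h|right; exact: rejects_sub h].
Qed.

(* If [a] is rejected, only finitely many of its one-point extensions can be
   accepted: infinitely many accepted ones would form a set accepting [a]. *)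
Let settles_dense a X : increasing X ->
  exists Y, [/\ increasing Y, range Y `<=` range X & settles a Y].
Proof.
move=> incX; have [Y0 [incY0 Y0X [aY0|rY0]]] := decides_dense a incX.
  by exists Y0; split=> //; left.
have [Y [incY YY0 decY]] : exists Y, [/\ increasing Y, range Y `<=` range Y0 &
    forall n b, subseq b (mkseq Y n) -> decides (a ++ b) (tail n Y)].
  apply: (fusion (R := fun b => decides (a ++ b)) _ _ incY0) => b X1.
    by move=> X2 _; exact: decides_sub.
  exact: decides_dense.
have rY : rejects a Y by exact: rejects_sub rY0.
have [N NP] : exists N, forall n, (N <= n)%N ->
    ~ accepts (rcons a (Y n)) (tail n.+1 Y).
  apply: contrapT => /forallNP noN.
  have [|e ince eP] := @infinite_increasing
      [set n | accepts (rcons a (Y n)) (tail n.+1 Y)].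
    by move=> N; have /existsNP[n /not_implyP[Nn /contrapT]] := noN N; exists n.
  apply: (rY (Y \o e)) => [i j ij|_ [k _ <-]|D incD DYe].
  - by apply: incY; apply: ince.
  - by exists (e k).
  have [k _ /= D0] := DYe _ (imageT D 0%N).
  have DY : range D `<=` range Y.
    by apply: subset_trans DYe _ => _ [l _ <-]; exists (e l).
  have [_ DtailY] := subseq_mkseq_range incD incY DY (esym D0).
  have DtY : range (tail 1 D) `<=` range (tail (e k).+1 Y).
    move=> _ [l _ <-]; have [[|j] _ Dj] := DtailY _ (imageT _ l.+1).
      by move: Dj; rewrite /tail addn0 D0 => /(increasing_inj incD).
    by exists j => //; rewrite /tail addSnnS.
  have := eP k (tail 1 D) (increasing_tail 1 incD) DtY.
  by rewrite D0 -cats1 prepend_cat (prepend_mkseq D 1).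
exists (tail N Y); split; first exact: increasing_tail.
  by apply: subset_trans Y0X; apply: subset_trans YY0; exact: range_tail.
right; split=> [|k]; first by apply: rejects_sub rY; exact: range_tail.
have [] := decY (N + k).+1 [:: tail N Y k].
- by rewrite sub1seq /tail map_f // mem_iota /= add0n.
- by rewrite cats1 => /NP; case; exact: leq_addr.
rewrite cats1 => rj; apply: (rejects_tail (n := k.+1)).
  exact: increasing_tail.
apply: rejects_sub rj => _ [l _ <-]; exists l => //.
by rewrite /tail !addnA addnS.
Qed.

Let settles_sub a X Y : range Y `<=` range X -> settles a X -> settles a Y.
Proof.
move=> YX [h|[h1 h2]]; first by left; exact: accepts_sub h.
right; split; first exact: rejects_sub h1.
by move=> k; have [j _ <-] := YX _ (imageT Y k); exact: rejects_sub (h2 j).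
Qed.

(** Pass by fusion to a set [Y] that settles all its finite subsets.  If [Y]
rejects the empty sequence, it rejects all its finite subsets, by induction on
their length.  A member of [C] inside [Y] would then have an initial segment
that forces membership in [C], and is thus accepted. *)
Lemma open_ramsey : ramsey C.
Proof.
move=> X incX; have [Y0 [incY0 Y0X [aY0|rY0]]] := decides_dense [::] incX.
  exists Y0; split=> //; left => D incD DY.
  by rewrite -(prepend_nil D); exact: aY0.
have [Y [incY YY0 stY]] : exists Y, [/\ increasing Y, range Y `<=` range Y0 &
    forall n a, subseq a (mkseq Y n) -> settles a (tail n Y)].
  apply: (fusion (R := settles) _ _ incY0) => a X1.
    by move=> X2 _; exact: settles_sub.
  exact: settles_dense.
exists Y; split=> //; first exact: subset_trans YY0 Y0X.
right => D incD DY CD.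
have rej m : forall n, subseq (mkseq D m) (mkseq Y n) ->
    rejects (mkseq D m) (tail n Y).
  elim: m => [|m IH] n.
    move=> _; apply: rejects_sub rY0.
    by apply: subset_trans YY0; exact: range_tail.
  rewrite mkseqS => subn; have [j _ Dm] := DY _ (imageT D m).
  have [sub_j _] := subseq_mkseq_range incD incY DY (esym Dm).
  have jn : (j < n)%N.
    have : D m \in mkseq Y n.
      by apply: (mem_subseq subn); rewrite mem_rcons mem_head.
    case/mapP => i; rewrite mem_iota /= add0n -Dm => i_n Yij.
    by rewrite (_ : j = i) //; exact: (increasing_inj incY).
  have rej_j := IH j sub_j.
  have [acc|[_ /(_ 0%N)]] := stY j _ sub_j.
    by case: (rej_j (tail j Y)); [exact: increasing_tail|exact: subset_refl|].
  rewrite {1}/tail addn0 Dm; apply: rejects_sub.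
  by apply: range_tail_le; exact: ltnW.
have [m mP] := openC CD; have [j _ Dm] := DY _ (imageT D m).
have [sub_j tDY] := subseq_mkseq_range incD incY DY (esym Dm).
apply: (rej m j sub_j _ (increasing_tail _ incD) tDY) => E incE EY.
apply: mP; apply: (@eq_from_nth _ 0%N); rewrite !size_mkseq // => i im.
by rewrite nth_mkseq // /prepend size_mkseq im.
Qed.

End OpenRamsey.

(** By fusion there is [Y] in which, for each finite subset [a] of size [m],
whether an end-extension of [a] belongs to [C m] depends on [a] only.
Inside [Y] the union is therefore open, and [open_ramsey] applies. *)
Lemma ramsey_bigcup (C : nat -> set (nat -> nat)) :
  (forall n, completely_ramsey (C n)) -> ramsey (\bigcup_n C n).
Proof.
move=> ramC X incX.
have [Y [incY YX homY]] : exists Y, [/\ increasing Y, range Y `<=` range X &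
    forall n a, subseq a (mkseq Y n) ->
      homogeneous (section a (C (size a))) (tail n Y)].
  apply: (fusion (R := fun a => homogeneous (section a (C (size a)))) _ _ incX).
    by move=> a X1 X2 _; exact: homogeneous_sub.
  by move=> a X1; exact: ramC.
pose O := [set D | exists m n, subseq (mkseq D m) (mkseq Y n) /\
  forall E, increasing E -> range E `<=` range (tail n Y) ->
    C m (prepend (mkseq D m) E)].
have openO : seq_open O.
  move=> D [m [n [sub_n DC]]]; exists m => E EDm.
  by exists m, n; rewrite EDm.
have OE D : increasing D -> range D `<=` range Y ->
    O D <-> (\bigcup_n C n) D.
  move=> incD DY; split=> [[m [n [sub_n DC]]]|[m _ CD]]; last first.
    have [j _ Dm] := DY _ (imageT D m).
    have [sub_j tDY] := subseq_mkseq_range incD incY DY (esym Dm).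
    exists m, j; split=> //; have [] := homY j _ sub_j; rewrite size_mkseq //.
    move=> /(_ _ (increasing_tail _ incD) tDY).
    by rewrite /section /= prepend_mkseq.
  (* The stage [n] witnessing [O D] may come later than the stage [j] at which
     [mkseq D m] first occurs, so [tail m D] need not lie in [tail n Y].
     Compare the two homogeneity statements on the common tail. *)
  exists m => //; have [j _ Dm] := DY _ (imageT D m).
  have [sub_j tDY] := subseq_mkseq_range incD incY DY (esym Dm).
  have [] := homY j _ sub_j; rewrite size_mkseq.
    move=> /(_ _ (increasing_tail _ incD) tDY).
    by rewrite /section /= prepend_mkseq.
  move=> /(_ (tail (maxn n j) Y) (increasing_tail _ incY)); case.
    by apply: range_tail_le; exact: leq_maxr.
  by apply: DC; [exact: increasing_tail|apply: range_tail_le; exact: leq_maxl].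
have [Z [incZ ZY homZ]] := open_ramsey openO incY.
exists Z; split=> //; first exact: subset_trans YX.
by case: homZ => h; [left|right] => D incD DZ; have := h D incD DZ;
  rewrite OE //; exact: subset_trans ZY.
Qed.

Lemma open_completely_ramsey C : seq_open C -> completely_ramsey C.
Proof.
move=> openC a; apply: open_ramsey => X CX; have [n nP] := openC _ CX.
exists n => Y YX; apply: nP; apply: (@eq_from_nth _ 0%N).
  by rewrite !size_mkseq.
rewrite size_mkseq => i i_n; rewrite !nth_mkseq // /prepend; case: ifP => // _.
have lt : (i - size a < n)%N by apply: leq_ltn_trans i_n; exact: leq_subr.
by rewrite -(nth_mkseq 0%N Y lt) YX nth_mkseq.
Qed.

Lemma completely_ramseyC C : completely_ramsey C -> completely_ramsey (~` C).
Proof.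
move=> ramC a X incX; have [Y [incY YX hom]] := ramC a X incX.
exists Y; split=> //; case: hom => h; [right|left] => D incD DY.
  by move=> /(_ (h D incD DY)).
exact: h.
Qed.

Lemma completely_ramsey_bigcup (C : nat -> set (nat -> nat)) :
  (forall n, completely_ramsey (C n)) -> completely_ramsey (\bigcup_n C n).
Proof.
move=> ramC a; rewrite /section.
have -> : [set X | (\bigcup_n C n) (prepend a X)] = \bigcup_n section a (C n).
  by apply/seteqP; split=> X [n _ h]; exists n.
by apply: ramsey_bigcup => n b; rewrite section_cat; exact: ramC.
Qed.

(** * Topology of sequences over a discrete space *)

Lemma eq_mkseqP (T : Type) (X Y : nat -> T) n :
  mkseq X n = mkseq Y n <-> forall i, (i < n)%N -> X i = Y i.
Proof.
elim: n => [//|n IH]; rewrite !mkseqS; split=> [/rcons_inj[/IH XY Xn] i|XY].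
  by rewrite ltnS leq_eqVlt => /predU1P[->|]; last exact: XY.
by congr rcons; [apply/IH => i i_n; apply: XY; exact: ltnW | exact: XY].
Qed.

Lemma eq_mkseq_le (T : Type) (X Y : nat -> T) m n : (m <= n)%N ->
  mkseq X n = mkseq Y n -> mkseq X m = mkseq Y m.
Proof.
move=> mn /eq_mkseqP XY; apply/eq_mkseqP => i im; apply: XY.
exact: leq_trans mn.
Qed.

(** Finite conditions on coordinates form a base of the product topology; the
filter generated by agreement on initial segments converges to [X] because it
does so coordinatewise. *)
Lemma nbhs_ptwsP (T : discreteTopologicalType) (X : {ptws nat -> T})
    (V : set {ptws nat -> T}) :
  nbhs X V <-> exists n, forall Y : nat -> T, mkseq Y n = mkseq X n -> V Y.
Proof.
split=> [XV|[n nP]].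
- pose F : set_system {ptws nat -> T} :=
    [set W | exists n, forall Y : nat -> T, mkseq Y n = mkseq X n -> W Y].
  have FF : Filter F.
    split=> [|U W [m mP] [n nP]|U W UW [n nP]].
    + by exists 0%N.
    + exists (maxn m n) => Y YX; split; [apply: mP|apply: nP].
        exact: eq_mkseq_le (leq_maxl m n) YX.
      exact: eq_mkseq_le (leq_maxr m n) YX.
    + by exists n => Y /nP; exact: UW.
  have : F --> X.
    apply/cvg_sup => i W; rewrite /= (@nbhsE (initial_topology _)).
    case=> B [[O oO <-] /= XO] BW; exists i.+1 => Y.
    rewrite !mkseqS => /rcons_inj[_ Yi]; apply: BW => /=; by rewrite Yi.
  by move=> /(_ _ XV).
- elim: n V nP => [|n IH] V nP.
    by apply: (@filterS _ _ (nbhs_filter X) setT) filterT => Y _; exact: nP.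
  have XIn := IH [set Y : nat -> T | mkseq Y n = mkseq X n] (fun _ => id).
  have Xn : nbhs X [set Y : {ptws nat -> T} | Y n = X n].
    have := @proj_continuous nat (fun=> T) n X [set X n].
    by apply; rewrite nbhs_principalE; exact/principal_filterP.
  have FX := nbhs_filter X.
  apply: (@filterS _ _ FX) (@filterI _ _ FX _ _ XIn Xn) => Y [/= Y1 Y2].
  by apply: nP; rewrite !mkseqS Y1 Y2.
Qed.

Lemma open_subspaceP (T : discreteTopologicalType) (A : set {ptws nat -> T})
    (U : set A) :
  open U <-> forall x, U x ->
    exists n, forall y : A, mkseq (val y) n = mkseq (val x) n -> U y.
Proof.
split=> [[V oV <-] x Vx|loc].
  have /nbhs_ptwsP[n nP] : nbhs (val x : {ptws nat -> T}) V.
    exact: open_nbhs_nbhs.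
  by exists n => y /nP.
exists [set X : {ptws nat -> T} | exists n, (forall y : A,
    mkseq (val y) n = mkseq X n -> U y)].
  rewrite openE => X [n nP]; apply/nbhs_ptwsP; exists n => Y YX.
  by exists n => y; rewrite YX; exact: nP.
apply/seteqP; split=> x /=; first by case=> n; exact.
exact: loc.
Qed.

(** * Borel sets and Borel maps *)

Lemma sigma_algebra_borel (T : topologicalType) :
  sigma_algebra setT (@borel T).
Proof. exact: smallest_sigma_algebra. Qed.

Lemma borel_ind (T : topologicalType) (G : set (set T)) :
  sigma_algebra setT G -> open `<=` G -> @borel T `<=` G.
Proof. by move=> sG oG; apply: smallest_sub. Qed.

Section BorelSets.
Variable T : topologicalType.
Implicit Types A B : set T.

Lemma borel_open A : open A -> borel A.
Proof. exact: sub_sigma_algebra. Qed.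

Lemma borel0 : borel (set0 : set T).
Proof. by have [] := sigma_algebra_borel T. Qed.

Lemma borelC A : borel A -> borel (~` A).
Proof. by have [_ + _] := sigma_algebra_borel T; rewrite -setTD; apply. Qed.

Lemma borel_countable_bigcup (I : Type) (D : set I) (F : I -> set T) :
  countable D -> (forall i, D i -> borel (F i)) ->
  borel (\bigcup_(i in D) F i).
Proof.
move=> /countable_injP[f injf] bF.
have -> : \bigcup_(i in D) F i =
    \bigcup_n \bigcup_(i in D `&` [set i | f i = n]) F i.
  apply/seteqP; split=> [x [i Di Fx]|x [n _ [i [Di _] Fx]]]; last by exists i.
  by exists (f i) => //; exists i.
have [_ _ bU] := sigma_algebra_borel T; apply: bU => n.
have [[i [Di fi]]|none] := pselect (exists i, D i /\ f i = n).
  rewrite (_ : D `&` _ = [set i]) ?bigcup_set1; first exact: bF.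
  apply/seteqP; split=> [j [Dj /= fj]|_ -> //].
  by apply: injf; rewrite ?inE // fj.
rewrite (_ : D `&` _ = set0) ?bigcup_set0; first exact: borel0.
by apply/seteqP; split=> // i Di; apply: none; exists i.
Qed.

Lemma borel_bigcup (F : nat -> set T) :
  (forall n, borel (F n)) -> borel (\bigcup_n F n).
Proof. by have [_ _] := sigma_algebra_borel T; apply. Qed.

Lemma borel_bigcap (F : nat -> set T) :
  (forall n, borel (F n)) -> borel (\bigcap_n F n).
Proof.
move=> bF; rewrite -[\bigcap_n F n]setCK setC_bigcap.
by apply: borelC; apply: borel_bigcup => n; exact: borelC.
Qed.

Lemma borelT : borel (setT : set T).
Proof. by rewrite -setC0; apply: borelC; exact: borel0. Qed.

Lemma borelI A B : borel A -> borel B -> borel (A `&` B).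
Proof.
move=> bA bB; rewrite -bigcap2E.
by apply: borel_bigcap => -[|[|n]] //=; exact: borelT.
Qed.

Lemma borel_countable_preimage (P : Type) (f : T -> P) :
  countable [set: P] -> (forall p, borel (f @^-1` [set p])) ->
  forall W, borel (f @^-1` W).
Proof.
move=> cP bf W; rewrite (_ : f @^-1` W = \bigcup_(p in W) f @^-1` [set p]).
  apply: borel_countable_bigcup => //.
  by apply: sub_countable cP; exact: subset_card_le.
by apply/seteqP; split=> [x Wx|x [p Wp /= ->] //]; exists (f x).
Qed.

End BorelSets.

Lemma borel_map_open (T U : topologicalType) (f : T -> U) :
  (forall B, open B -> borel (f @^-1` B)) -> borel_map f.
Proof.
move=> fo; apply: borel_ind => //; split=> [|A fA|A fA].
- by rewrite /= preimage_set0; exact: borel0.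
- by rewrite /= setTD preimage_setC; exact: borelC.
- by rewrite /= preimage_bigcup; exact: borel_bigcup.
Qed.

Lemma borel_map_comp (T U V : topologicalType) (f : T -> U) (g : U -> V) :
  borel_map f -> borel_map g -> borel_map (g \o f).
Proof. by move=> bf bg B bB; exact: (bf _ (bg _ bB)). Qed.

Lemma countable_seq (P : Type) : countable [set: P] -> countable [set: seq P].
Proof.
move=> /countable_injP[f injf]; apply/countable_injP.
exists (choice.pickle \o map f) => s t _ _ /(pcan_inj choice.pickleK).
by apply: inj_map => p q; apply: injf; rewrite inE.
Qed.

Section SequenceMaps.
Variables (T : topologicalType) (P : Type) (F : T -> nat -> P).
Hypothesis P_countable : countable [set: P].
Hypothesis F_borel : forall k p, borel [set x | F x k = p].

Lemma borel_mkseq n (W : set (seq P)) : borel [set x | W (mkseq (F x) n)].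
Proof.
apply: (@borel_countable_preimage _ _ (fun x => mkseq (F x) n)).
  exact: countable_seq.
elim: n => [|n IH] s.
  have [<-|ns] := pselect ([::] = s).
    by rewrite (_ : _ @^-1` _ = setT); [exact: borelT|exact/seteqP].
  rewrite (_ : _ @^-1` _ = set0); first exact: borel0.
  by apply/seteqP; split=> // x /= /ns.
case/lastP: s => [|s p].
  rewrite (_ : _ @^-1` _ = set0); first exact: borel0.
  by apply/seteqP; split=> // x /=; rewrite mkseqS => /(congr1 size);
    rewrite size_rcons.
rewrite (_ : _ @^-1` _ =
  (fun x => mkseq (F x) n) @^-1` [set s] `&` [set x | F x n = p]).
  by apply: borelI; [exact: IH|exact: F_borel].
apply/seteqP; split=> x /=; first by rewrite mkseqS => /rcons_inj[].
by rewrite mkseqS => -[-> ->].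
Qed.

(** A function of finitely many coordinates factors through the countable set
of finite sequences, so every preimage is a countable union of cylinders. *)
Lemma borel_local (Z : Type) (g : T -> Z) n :
  (forall x y, mkseq (F x) n = mkseq (F y) n -> g x = g y) ->
  forall W, borel (g @^-1` W).
Proof.
move=> gloc W; rewrite (_ : _ @^-1` _ = [set x | [set s | exists2 y,
  s = mkseq (F y) n & W (g y)] (mkseq (F x) n)]); first exact: borel_mkseq.
by apply/seteqP; split=> x /= => [Wx|[y /gloc -> //]]; exists x.
Qed.

End SequenceMaps.

(** Countability of [P] makes every open set a countable union of cylinders, so
that measurability can be tested one coordinate at a time. *)
Lemma borel_map_sequences (T : topologicalType) (P : discreteTopologicalType)
    (A : set {ptws nat -> P}) (G : T -> A) :
  countable [set: P] -> (forall k p, borel [set x | val (G x) k = p]) ->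
  borel_map G.
Proof.
move=> cP bG; apply: borel_map_open => U oU.
rewrite (_ : G @^-1` U = \bigcup_n [set x | [set s | forall y : A,
    mkseq (val y) n = s -> U y] (mkseq (val (G x)) n)]).
  by apply: borel_bigcup => n; exact: borel_mkseq.
apply/seteqP; split=> [x Ux|x [n _ /= h]]; last exact: h.
by have [n nP] := (open_subspaceP U).1 oU _ Ux; exists n.
Qed.

Lemma borel_coordinate (P : discreteTopologicalType) (A : set {ptws nat -> P})
    k (W : set P) : borel [set x : A | W (val x k)].
Proof.
apply: borel_open; apply/open_subspaceP => x Wx; exists k.+1 => y /eq_mkseqP yx.
by rewrite /= yx.
Qed.

Lemma remove_min_borel : borel_map remove_min.
Proof.
apply: borel_map_sequences => [|k p]; first exact: countableP.
exact: (@borel_coordinate _ inf_subsets k.+1 [set p]).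
Qed.

Lemma increasing_inf_subsets (B : inf_subsets) : increasing (val B).
Proof. by have /set_mem := valP B. Qed.

Definition inf_subset X (incX : increasing X) : inf_subsets :=
  exist _ X (mem_set incX).

(** * The Galvin-Prikry theorem *)

(** The traces on the increasing sequences of completely Ramsey sets of arbitrary
sequences form a sigma-algebra containing the open sets. *)
Theorem galvin_prikry (C : set inf_subsets) : borel C -> exists A : inf_subsets,
  (forall B : inf_subsets, elements B `<=` elements A -> C B) \/
  (forall B : inf_subsets, elements B `<=` elements A -> ~ C B).
Proof.
pose G : set (set inf_subsets) :=
  [set C | exists2 C', completely_ramsey C' & C = val @^-1` C'].
suff sub : @borel inf_subsets `<=` G.
  move=> /sub[C' ramC' ->].
  have [|Y [incY _ homY]] := @ramC' [::] id.
    by [].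
  exists (inf_subset incY).
  by case: homY => h; [left|right] => B BY;
    have := h _ (increasing_inf_subsets B) BY; rewrite /section /= prepend_nil.
apply: borel_ind; first split.
- exists set0 => //; apply: open_completely_ramsey => X [].
- move=> _ [C' ramC' ->]; exists (~` C'); first exact: completely_ramseyC.
  by rewrite setTD.
- move=> F FG; have /choice[F' F'P] n : exists C', completely_ramsey C' /\
    F n = val @^-1` C' by have [C' ? ?] := FG n; exists C'.
  exists (\bigcup_n F' n).
    by apply: completely_ramsey_bigcup => n; have [] := F'P n.
  rewrite preimage_bigcup; apply: eq_bigcupr => n _; by have [] := F'P n.
- move=> U oU.
  exists [set X | exists n, forall y : inf_subsets,
     mkseq (val y) n = mkseq X n -> U y].
    apply: open_completely_ramsey => X [n nP]; exists n => Y YX.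
    by exists n => y; rewrite YX; exact: nP.
  apply/seteqP; split=> x /=; last by case=> n; exact.
  exact: (open_subspaceP U).1.
Qed.

(** * Chromatic numbers and the space of bad sequences *)

Lemma borel_discrete (T : discreteTopologicalType) (W : set T) : borel W.
Proof.
apply: borel_open; rewrite openE => x Wx.
by rewrite /interior nbhs_principalE; exact/principal_filterP.
Qed.

(** Among the finite cardinalities up to [n] there is a least one realised by a
Polish space that colours the graph, and such a space is a chromatic number. *)
Lemma chromatic_number_le (R : realType) (V : topologicalType)
    (E : V -> V -> Prop) (n : nat) (Y : topologicalType) :
  polish R Y -> borel_colorable E Y -> ([set: Y] #<= `I_n)%card ->
  borel_chromatic_number_le R E n.
Proof.
move=> polY colY Yn.
pose small k := `[< exists Z : topologicalType,
  [/\ polish R Z, borel_colorable E Z & ([set: Z] #<= `I_k)%card] >].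
have ex_small : exists k, small k by exists n; apply/asboolP; exists Y.
have [m /asboolP[Z [polZ colZ Zm]] min_m] := ex_minnP ex_small.
have mn : (m <= n)%N by apply: min_m; apply/asboolP; exists Y.
exists Z; last by apply: card_le_trans Zm _; rewrite card_le_II.
split=> // Z' polZ' colZ'; apply: card_le_trans Zm _.
have [/finite_setP[k Z'k]|/infiniteP natZ'] := pselect (finite_set [set: Z']).
  rewrite (card_le_eqr Z'k) card_le_II; apply: min_m; apply/asboolP.
  by exists Z'; split=> //; rewrite (card_le_eql Z'k).
by apply: card_le_trans natZ'; exact: subset_card_le.
Qed.

Definition bad_seq (Q : choiceType) (le : Q -> Q -> Prop) (X : nat -> Q)
  (badX : forall k, ~ le (X k) (X k.+1)) : vec le := exist _ X (mem_set badX).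

Lemma vec_bad (Q : choiceType) (le : Q -> Q -> Prop) (X : vec le) k :
  ~ le (val X k) (val X k.+1).
Proof. by have /set_mem := valP X; apply. Qed.

Definition vec_shift (Q : choiceType) (le : Q -> Q -> Prop) (X : vec le) :
  vec le := bad_seq (fun k => @vec_bad _ _ X k.+1).

Lemma borel_map_iter (T : topologicalType) (f : T -> T) k :
  borel_map f -> borel_map (iter k f).
Proof.
by move=> bf; elim: k => [//|k IH]; exact: (borel_map_comp IH bf).
Qed.

(** * Thinness is inherited along Borel maps of bad sequences *)

Section Reduction.
Variables (R : realType) (Q P : choiceType).
Variables (le : Q -> Q -> Prop) (leP : P -> P -> Prop).
Hypothesis Q_thin : countable_thin R le.
Hypothesis P_qo : quasi_order leP.
Hypothesis P_countable : countable [set: P].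
Variable psi : vec leP -> discrete_topology Q.
Hypothesis psi_borel : borel_map psi.
Hypothesis psi_bad : forall X, ~ le (psi X) (psi (vec_shift X)).

Let Q_countable : countable [set: Q].
Proof. by have [[]] := Q_thin. Qed.

Let le_refl x : le x x.
Proof. by have [[_ [[refl _] _]]] := Q_thin. Qed.

Let vec_shift_borel : borel_map (@vec_shift P leP).
Proof.
apply: borel_map_sequences => // k p.
exact: (@borel_coordinate _ (vec leP) k.+1 [set p]).
Qed.

Let Psi X : vec le :=
  bad_seq (fun k => @psi_bad (iter k (@vec_shift P leP) X)).

Let Psi_borel : borel_map Psi.
Proof.
apply: borel_map_sequences => // k q /=.
apply: (borel_map_comp (borel_map_iter k vec_shift_borel) psi_borel
  (B := [set q])).
exact: borel_discrete.
Qed.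

Let Psi_shift X Y : shift (val X) = val Y -> shift (val (Psi X)) = val (Psi Y).
Proof.
move=> XY; apply/funext => k; rewrite /shift /= -iterS iterSr.
by congr (psi (iter k _ _)); apply: val_inj.
Qed.

(* Otherwise the bad sequence [Psi X] would be fixed by the shift, and its
   first two terms would be equal. *)
Let Psi_neq X Y : shift (val X) = val Y -> Psi X <> Psi Y.
Proof.
move=> XY PXY; apply: (@vec_bad _ _ (Psi X) 0%N).
have -> : val (Psi X) 1%N = val (Psi X) 0%N; last exact: le_refl.
by have := congr1 (@^~ 0%N) (Psi_shift XY); rewrite -PXY.
Qed.

Lemma reduction_chromatic : borel_chromatic_number_le R (@vec_adj P leP) 3.
Proof.
have [_ [Y [polY [c bc cP] _] Y3]] := Q_thin.
apply: chromatic_number_le polY _ Y3.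
exists (c \o Psi); first exact: borel_map_comp bc.
move=> X1 X2 [_ [X12|X21]]; apply: cP.
  by split; [exact: Psi_neq|left; exact: Psi_shift].
by split; [apply/nesym; exact: Psi_neq|right; exact: Psi_shift].
Qed.

(** By [galvin_prikry] it is enough to exclude a Borel map bad on all infinite
subsets of some [A]; after reindexing along [A], such a map is bad on all
infinite sets, and composing with [psi] contradicts the property of [Q]. *)
Lemma reduction_bqo : bqo leP.
Proof.
split=> // f bf.
have rm_borel k : borel_map (iter k remove_min).
  exact: borel_map_iter remove_min_borel.
have rm_iter k p : borel [set B | f (iter k remove_min B) = p].
  apply: (borel_map_comp (rm_borel k) bf (B := [set p])).
  exact: borel_discrete.
have good_borel : borel [set B | leP (f B) (f (remove_min B))].
  have := @borel_local _ _ (fun B k => f (iter k remove_min B)) P_countable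
    rm_iter _ (fun B => leP (f B) (f (remove_min B))) 2 _ id.
  by apply=> B B' [-> ->].
have [A [goodA|badA]] := galvin_prikry good_borel; first by exists A.
have incA (B : inf_subsets) : increasing (val A \o val B).
  by move=> i j ij; do 2!apply: increasing_inf_subsets.
pose incl B := inf_subset (incA B).
have incl_borel : borel_map incl.
  apply: borel_map_sequences => [|k p]; first exact: countableP.
  exact: (@borel_coordinate _ inf_subsets k [set j | val A j = p]).
pose f' := f \o incl.
have f'_bad B : ~ leP (f' B) (f' (remove_min B)).
  have -> : f' (remove_min B) = f (remove_min (incl B)).
    by congr f; exact: val_inj.
  by apply: badA => _ [k _ <-]; exists (val B k).
pose F B : vec leP := bad_seq (fun k => f'_bad (iter k remove_min B)).
have F_borel : borel_map F.
  apply: borel_map_sequences => // k p /=.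
  apply: (borel_map_comp (borel_map_comp (rm_borel k) incl_borel) bf
    (B := [set p])).
  exact: borel_discrete.
have [_ [_ bqoQ]] := Q_thin.1.
have [B /(_ B (@subset_refl _ _))] :=
  bqoQ (psi \o F) (borel_map_comp F_borel psi_borel).
have -> : (psi \o F) (remove_min B) = psi (vec_shift (F B));
  last by move=> /psi_bad.
congr psi; apply: val_inj; apply/funext => k /=.
by rewrite /shift -iterSr.
Qed.

Theorem reduction_thin : countable_thin R leP.
Proof.
by split; [split; [|exact: reduction_bqo]|exact: reduction_chromatic].
Qed.

End Reduction.

(** * Finite sets *)

Section FiniteSets.
Variables (Q : choiceType) (le : Q -> Q -> Prop).

Lemma fset_le_qo : quasi_order le -> quasi_order (@fset_le Q le).
Proof.
case=> refl trans; split=> [a|a b c [f fP] [g gP]]; first by exists id.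
by exists (g \o f) => q; apply: trans (fP q) (gP _).
Qed.

Lemma countable_finsets : countable [set: Q] -> countable [set: {fset Q}].
Proof.
move=> /countable_seq/countable_injP[f injf]; apply/countable_injP.
exists (fun a : {fset Q} => f (enum_fset a)) => a b _ _ /injf ab.
have {}ab := ab (mem_setT _) (mem_setT _).
by apply/fsetP => q; have := congr1 (fun s => q \in s) ab.
Qed.

Lemma not_fset_le (a b : {fset Q}) : ~ fset_le le a b ->
  exists2 q, q \in a & forall r, r \in b -> ~ le q r.
Proof.
move=> nab; apply: contrapT => none; apply: nab.
have /choice[f fP] (q : a) : exists r : b, le (val q) (val r).
  apply: contrapT => noq; apply: none; exists (val q); first exact: valP.
  by move=> r rb qr; apply: noq; exists [` rb]%fset.
by exists f.
Qed.

Definition uncovered (a b : {fset Q}) (nab : ~ fset_le le a b) : Q :=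
  s2val (cid2 (not_fset_le nab)).

Lemma uncovered_eq (a a' b b' : {fset Q}) (h : ~ fset_le le a b)
  (h' : ~ fset_le le a' b') : a = a' -> b = b' -> uncovered h = uncovered h'.
Proof.
by move=> ea eb; subst; congr uncovered; exact: Prop_irrelevance.
Qed.

(** The element of [X 0] left uncovered by [X 1] is in particular not below the
element of [X 1] left uncovered by [X 2]. *)
Lemma fset_thin (R : realType) :
  countable_thin R le -> countable_thin R (@fset_le Q le).
Proof.
move=> Q_thin; have [[cQ [qoQ _]] _] := Q_thin.
pose psi (X : vec (@fset_le Q le)) : discrete_topology Q :=
  uncovered (@vec_bad _ _ X 0%N).
apply: (@reduction_thin R Q _ le _ Q_thin _ _ psi).
- exact: fset_le_qo.
- exact: countable_finsets.
- move=> B _; apply: (@borel_local _ _ (fun X : vec _ => val X)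
    (countable_finsets cQ) _ _ psi 2).
    by move=> k p; exact: (@borel_coordinate _ (vec (@fset_le Q le)) k [set p]).
  by move=> X Y /eq_mkseqP XY; apply: uncovered_eq; exact: XY.
- move=> X; rewrite /psi /uncovered.
  case: cid2 => /= q _ qP; case: cid2 => /= r rX _; exact: qP.
Qed.

End FiniteSets.

(** * Finite labelled trees *)

Section Subtrees.
Variables (T : Type) (leT : T -> T -> Prop) (x : T).
Hypothesis treeT : is_tree leT.

Let above := {v : T | leT x v}.
Let le_above (u v : above) := leT (sval u) (sval v).

Lemma is_tree_above : is_tree le_above.
Proof.
have [[refl trans anti] wo _] := treeT; split.
- split=> [u|u v w|[u xu] [v xv] uv vu]; [exact: refl|exact: trans|].
  exact/eq_exist/anti.
- move=> t S St [s0 Ss0].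
  have [||m [m' Sm' <-] mP] := wo (sval t) (sval @` S).
  + by move=> _ [s Ss <-]; exact: St.
  + by exists (sval s0); exists s0.
  + by exists m' => // s Ss; apply: mP; exists s.
- by exists (exist _ x (refl x)) => v; exact: (svalP v).
Qed.

Lemma finite_above : finite_set [set: T] -> finite_set [set: above].
Proof.
move=> finT; rewrite -(preimage_setT (@sval T (leT x))).
by apply: finite_preimage finT => u v _ _; exact: eq_sig_hprop.
Qed.

End Subtrees.

Section Trees.
Variables (Q : Type) (le : Q -> Q -> Prop).
Implicit Types T : labeled_tree Q.

Let tle := @labeled_tree_le Q le.

Lemma labeled_tree_le_qo : quasi_order le -> quasi_order tle.
Proof.
case=> refl trans; split=> [T|T1 T2 T3 [f [f_le f_lab]] [g [g_le g_lab]]].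
  by exists id.
exists (g \o f); split=> [x y xy|x]; first by apply: g_le; exact: f_le.
exact: trans (f_lab x) (g_lab _).
Qed.

Lemma root_ex T : exists r : node T, forall t, tree_le r t.
Proof. by have [] := tree_leP T. Qed.

Definition tree_root T : node T := sval (cid (root_ex T)).

Lemma root_le T (t : node T) : tree_le (tree_root T) t.
Proof. exact: (svalP (cid (root_ex T))). Qed.

Definition root_label T : Q := label (tree_root T).

Definition subtree T (x : node T) : labeled_tree Q :=
  @LabeledTree Q {v : node T | tree_le x v}
    (fun u v => tree_le (sval u) (sval v)) (fun u => label (sval u))
    (@finite_above _ (@tree_le Q T) x (node_finite T))
    (@is_tree_above _ (@tree_le Q T) x (tree_leP T)).

(** Repetitions are allowed, so that [tree_size] below, the least such [n], is
the number of nodes.  Restricting a list to a subtree then bounds the size of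
the subtree with no comparison of cardinals between different types. *)
Definition listed_by (A : Type) (n : nat) : Prop :=
  exists2 s : seq {classic A}, size s = n & forall x, x \in s.

Lemma nodes_ex T : exists s : seq {classic node T}, forall x, x \in s.
Proof.
have /(@finite_seqP {classic node T})[s sP] := node_finite T.
by exists s => x; have : [set: {classic node T}] x by []; rewrite sP.
Qed.

Lemma listed_ex T : exists n, `[< listed_by (node T) n >].
Proof. by have [s sP] := nodes_ex T; exists (size s); apply/asboolP; exists s. Qed.

Definition tree_size T : nat := ex_minn (listed_ex T).

Lemma subtree_size T (x : node T) :
  x <> tree_root T -> (tree_size (subtree x) < tree_size T)%N.
Proof.
move=> xr; rewrite [in X in (_ < X)%N]/tree_size.
case: ex_minnP => _ /asboolP[s <- s_all] _.
rewrite /tree_size; case: ex_minnP => m _ m_min.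
pose part (v : {classic node T}) : option {classic node (subtree x)} :=
  if pselect (tree_le x v) is left xv then Some (exist _ v xv) else None.
have /m_min ms : `[< listed_by (node (subtree x)) (size (pmap part s)) >].
  apply/asboolP; exists (pmap part s) => // -[v xv].
  rewrite mem_pmap; apply/mapP; exists v => //; rewrite /part.
  by case: pselect => // xv'; congr (Some (exist _ _ _)); exact: Prop_irrelevance.
apply: leq_ltn_trans ms _; rewrite size_pmap ltn_neqAle count_size andbT.
rewrite -all_count; apply/allPn; exists (tree_root T) => //.
rewrite /part; case: pselect => // xr'; case: xr.
have [[_ _ anti] _ _] := tree_leP T.
exact: anti xr' (root_le x).
Qed.

Lemma subtree_le T (x : node T) : quasi_order le -> tle (subtree x) T.
Proof. by case=> refl _; exists sval; split=> [[u xu] [v xv]|u]. Qed.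

(** [c] is the child of the root lying below [v] or equal to it. *)
Definition is_branch T (v c : node T) : Prop :=
  [/\ tree_le c v, c <> tree_root T &
      forall u, tree_le u v -> u <> tree_root T -> tree_le c u].

Lemma branch_ex T (v : node T) : v <> tree_root T -> exists c, is_branch v c.
Proof.
move=> vr; have [[refl _ _] wo _] := tree_leP T.
have [||c [cv cr] cP] := wo v [set u | tree_le u v /\ u <> tree_root T].
- by move=> u [].
- by exists v; split=> //; exact: refl.
- by exists c; split=> // u uv ur; exact: cP.
Qed.

Lemma branch_uniq T (v w c d : node T) :
  is_branch v c -> is_branch w d -> tree_le v w -> c = d.
Proof.
have [[_ trans anti] _ _] := tree_leP T.
move=> [cv cr cP] [dw dr dP] vw.
have dc : tree_le d c by apply: dP => //; exact: trans cv vw.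
by apply: anti => //; apply: cP => //; exact: trans dc cv.
Qed.

(** The branches at the root are pairwise incomparable, so maps given on each of
them can be glued, sending the root to the root. *)
Lemma labeled_tree_le_subtrees T1 T2 :
    le (root_label T1) (root_label T2) ->
    (forall x : node T1, x <> tree_root T1 -> tle (subtree x) T2) ->
  tle T1 T2.
Proof.
move=> le_root le_sub.
have [[refl1 trans1 anti1] _ _] := tree_leP T1.
have [[refl2 _ _] _ _] := tree_leP T2.
have /choice[h hP] (c : node T1) : exists h : node T1 -> node T2,
    c <> tree_root T1 -> (forall v w, tree_le c v -> tree_le v w -> tree_le (h v) (h w)) /\
    (forall v, tree_le c v -> le (label v) (label (h v))).
  have [->|cr] := pselect (c = tree_root T1).
    by exists (fun=> tree_root T2).
  have [f [f_le f_lab]] := le_sub c cr.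
  exists (fun v => if pselect (tree_le c v) is left cv
    then f (exist _ v cv) else tree_root T2) => _; split=> [v w cv vw|v cv].
    case: pselect => // cv'; case: pselect => [cw|[]]; first exact: f_le.
    exact: trans1 vw.
  by case: pselect => // cv'; exact: f_lab (exist _ v cv').
have /choice[br brP] (v : node T1) :
    exists c, v <> tree_root T1 -> is_branch v c.
  have [->|vr] := pselect (v = tree_root T1); first by exists (tree_root T1).
  by have [c cP] := branch_ex vr; exists c.
pose f v :=
  if pselect (v = tree_root T1) is left _ then tree_root T2 else h (br v) v.
exists f; split=> [v w vw|v]; rewrite /f.
  case: pselect => [vr|vr]; first exact: root_le.
  case: pselect => [wr|wr].
    by case: vr; apply: anti1 (root_le _); rewrite -wr.
  rewrite -(branch_uniq (brP v vr) (brP w wr) vw).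
  have [cv cr _] := brP v vr.
  exact: (hP _ cr).1.
case: pselect => [->//|vr]; have [cv cr _] := brP v vr.
exact: (hP _ cr).2.
Qed.

Hypothesis le_qo : quasi_order le.

Let tle_trans T1 T2 T3 : tle T1 T2 -> tle T2 T3 -> tle T1 T3.
Proof. by have [_ trans] := labeled_tree_le_qo le_qo; exact: trans. Qed.

(** What the descent from [T1] uses of a proper subtree.  The condition on the
root labels makes [descend] stop exactly where the labels are already bad. *)
Definition proper_descent T1 T2 T : Prop :=
  [/\ le (root_label T1) (root_label T2), (tree_size T < tree_size T1)%N,
      tle T T1 & ~ tle T T2].

Definition descend T1 T2 : labeled_tree Q :=
  if pselect (exists T, proper_descent T1 T2 T) is left ex
  then sval (cid ex) else T1.

Lemma descendP T1 T2 : ~ tle T1 T2 ->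
  [/\ ~ tle (descend T1 T2) T2, tle (descend T1 T2) T1 &
      descend T1 T2 = T1 /\ ~ le (root_label T1) (root_label T2) \/
      (tree_size (descend T1 T2) < tree_size T1)%N].
Proof.
move=> nle; rewrite /descend; case: pselect => [ex|none].
  by case: cid => T [_ lt_size T_T1 nT] /=; split=> //; right.
split=> //; first by have [refl _] := labeled_tree_le_qo le_qo; exact: refl.
left; split=> // le_root; apply: nle.
apply: labeled_tree_le_subtrees => // x xr; apply: contrapT => nx.
by apply: none; exists (subtree x); split=> //;
  [exact: subtree_size|exact: subtree_le].
Qed.

(** All positions move simultaneously, which makes the construction commute
with the shift. *)
Fixpoint stage (X : nat -> labeled_tree Q) (t : nat) : nat -> labeled_tree Q :=
  if t is s.+1 then fun k => descend (stage X s k) (stage X s k.+1) else X.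

Lemma stage_shift X t k : stage (shift X) t k = stage X t k.+1.
Proof. by elim: t k => [//|t IH] k /=; rewrite !IH. Qed.

Lemma stage_local X Y t k :
  (forall i, (i <= k + t)%N -> X i = Y i) -> stage X t k = stage Y t k.
Proof.
elim: t k => [|t IH] k XY /=; first by apply: XY; exact: leq_addr.
rewrite !IH // => i ik; apply: XY; first by rewrite addnS -addSn.
by apply: leq_trans ik _; rewrite leq_add2l.
Qed.

Section BadSequence.
Variable X : nat -> labeled_tree Q.
Hypothesis badX : forall k, ~ tle (X k) (X k.+1).

Lemma stage_bad t k : ~ tle (stage X t k) (stage X t k.+1).
Proof.
elim: t k => [//|t IH] k /=; have [nle _ _] := descendP (IH k).
have [_ le' _] := descendP (IH k.+1) => h; apply: nle.
exact: tle_trans h le'.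
Qed.

(** Any change at position [k] decreases the size there, so nothing changes
after the size has reached its minimum. *)
Lemma stage_stable k :
  exists N, forall t, (N <= t)%N -> stage X t k = stage X N k.
Proof.
have ex_size : exists n, `[< exists t, tree_size (stage X t k) = n >].
  by exists (tree_size (X k)); apply/asboolP; exists 0%N.
have [n /asboolP[N <-] min_n] := ex_minnP ex_size.
exists N; elim=> [|t IH]; first by rewrite leqn0 => /eqP ->.
rewrite leq_eqVlt => /predU1P[<- //|Nt].
rewrite -(IH Nt); have [_ _ [[//]|lt_size]] := descendP (@stage_bad t k).
have := min_n (tree_size (stage X t.+1 k)); rewrite leqNgt -(IH Nt) lt_size.
by move=> /(_ _)/negP[] //; apply/asboolP; exists t.+1.
Qed.

Definition limit_label : Q :=
  root_label (stage X (sval (cid (stage_stable 0))) 0).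

Lemma limit_labelP : exists N, forall t, (N <= t)%N ->
  root_label (stage X t 0) = limit_label.
Proof.
exists (sval (cid (stage_stable 0))) => t.
by rewrite /limit_label; case: cid => N NP /= /NP ->.
Qed.

End BadSequence.

(** At a stage where positions [0] and [1] have reached their limit labels and
position [0] no longer moves, comparable labels would force it to move. *)
Lemma limit_label_bad X (badX : forall k, ~ tle (X k) (X k.+1))
    (badSX : forall k, ~ tle (shift X k) (shift X k.+1)) :
  ~ le (limit_label badX) (limit_label badSX).
Proof.
have [N NP] := limit_labelP badX; have [M MP] := limit_labelP badSX.
have [K KP] := stage_stable badX 0.
pose t := maxn (maxn N M) K.
have tN : (N <= t)%N by rewrite /t -maxnA leq_maxl.
have tM : (M <= t)%N by rewrite /t maxnAC leq_maxr.
have tK : (K <= t)%N by rewrite leq_maxr.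
rewrite -(NP t tN) -(MP t tM) stage_shift.
have [_ _ [[]//|]] := descendP (@stage_bad X badX t 0).
rewrite -[descend _ _]/(stage X t.+1 0) (KP _ tK) (KP t.+1) ?ltnn //.
exact: leqW.
Qed.

End Trees.

Section TreeThin.
Variables (R : realType) (Q : choiceType) (le : Q -> Q -> Prop).
Hypothesis Q_thin : countable_thin R le.

Let le_qo : quasi_order le.
Proof. by have [[_ []]] := Q_thin. Qed.

(** The limit label takes the value [q] iff from some stage on the label of the
stage is [q], and each stage depends on finitely many trees. *)
Lemma countable_trees_thin (P : choiceType) (tree : P -> labeled_tree Q) :
  countable [set: P] ->
  countable_thin R (fun p q => labeled_tree_le le (tree p) (tree q)).
Proof.
move=> cP; set leP := fun p q => _.
pose badX (X : vec leP) k :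
    ~ labeled_tree_le le (tree (val X k)) (tree (val X k.+1)) :=
  @vec_bad _ _ X k.
pose psi (X : vec leP) : discrete_topology Q :=
  @limit_label Q le le_qo (tree \o val X) (badX X).
apply: (@reduction_thin R Q _ le _ Q_thin _ cP psi).
- have [refl trans] := labeled_tree_le_qo le_qo.
  by split=> [p|p q r]; [exact: refl|exact: trans].
- move=> B _.
  rewrite (_ : psi @^-1` B = \bigcup_N \bigcap_t
      (fun X : vec leP => root_label (stage le (tree \o val X) (N + t) 0)) @^-1` B).
    apply: borel_bigcup => N; apply: borel_bigcap => t.
    apply: (@borel_local _ _ (fun X : vec leP => val X) cP _ _ _ (N + t).+1).
      by move=> k p; exact: (@borel_coordinate _ (vec leP) k [set p]).
    move=> X Y /eq_mkseqP XY; congr root_label; apply: stage_local => i it /=.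
    by rewrite XY.
  apply/seteqP; split=> X /=.
    have [N NP] := limit_labelP le_qo (badX X).
    by move=> BX; exists N => // t _ /=; rewrite NP // leq_addr.
  case=> N _ NB; have [M MP] := limit_labelP le_qo (badX X).
  have := NB M I; rewrite /= MP //; exact: leq_addl.
- by move=> X; exact: limit_label_bad.
Qed.

Definition nodes (T : labeled_tree Q) : seq {classic node T} :=
  sval (cid (nodes_ex T)).

(** The order matrix and the labels along an enumeration of the nodes.  The code
depends on the enumeration chosen, but trees with equal codes map to each
other. *)
Definition code (T : labeled_tree Q) : seq (seq bool) * seq Q :=
  ([seq [seq `[< tree_le x y >] | y <- nodes T] | x <- nodes T],
   [seq label x | x <- nodes T]).

Lemma code_le (T1 T2 : labeled_tree Q) :
  code T1 = code T2 -> labeled_tree_le le T1 T2.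
Proof.
have [refl _] := le_qo; case=> eq_le eq_lab.
have eq_size : size (nodes T1) = size (nodes T2).
  by have := congr1 size eq_lab; rewrite !size_map.
pose pos (x : node T1) := @index {classic node T1} x (nodes T1).
have nth_pos x : nth (tree_root T1) (nodes T1) (pos x) = x.
  exact: (@nth_index {classic node T1} _ _ _ (svalP (cid (nodes_ex T1)) x)).
have lt1 x : (pos x < size (nodes T1))%N.
  by rewrite index_mem; exact: (svalP (cid (nodes_ex T1))).
have lt2 x : (pos x < size (nodes T2))%N by rewrite -eq_size.
exists (fun x => nth (tree_root T2) (nodes T2) (pos x)); split=> [x y xy|x].
  have := congr1 (fun l => nth false (nth [::] l (pos x)) (pos y)) eq_le.
  rewrite /= (nth_map (tree_root T1)) // (nth_map (tree_root T1)) //.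
  rewrite (nth_map (tree_root T2)) // (nth_map (tree_root T2)) // !nth_pos.
  by rewrite (asboolT xy) => /esym/asboolP.
have := congr1 (fun l => nth (root_label T1) l (pos x)) eq_lab.
rewrite /= (nth_map (tree_root T1)) // (nth_map (tree_root T2)) // nth_pos => ->.
exact: refl.
Qed.

(** Replacing each tree by one chosen for its code changes a map [f] only up to
equivalence, and leaves countably many values. *)
Lemma labeled_tree_bqo : bqo (@labeled_tree_le Q le).
Proof.
split=> [|f bf]; first exact: labeled_tree_le_qo.
have [[cQ _] _] := Q_thin.
pose P := set_type (range code).
have cP : countable [set: P].
  rewrite (eq_countable (card_setT _)).
  apply: sub_countable (countableX (countableP [set: seq (seq bool)])
    (countable_seq cQ)).
  by apply: subset_card_le => x _; split.
have tree_ex (p : P) : exists T, code T = val p.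
  by have /set_mem[T _ TP] := valP p; exists T.
pose tree p := sval (cid (tree_ex p)).
pose coded T : P := exist _ (code T) (mem_set (imageT code T)).
have code_tree T : code (tree (coded T)) = code T by rewrite /tree; case: cid.
have [[_ [_ bqoP]] _] := countable_trees_thin tree cP.
have [|A AP] := bqoP (coded \o f : inf_subsets -> discrete_topology P).
  move=> B _; apply: (bf (coded @^-1` B)); exact: borel_discrete.
have [_ trans] := labeled_tree_le_qo le_qo.
exists A => B /AP h.
apply: (trans _ _ _ (code_le (esym (code_tree (f B))))).
exact: (trans _ _ _ h (code_le (code_tree (f (remove_min B))))).
Qed.

Lemma labeled_tree_thin : thin R (@labeled_tree_le Q le).
Proof.
split=> [|A A_nat]; first exact: labeled_tree_bqo.
apply: (@countable_trees_thin A val).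
by rewrite (eq_countable (card_setT _)) (eq_countable A_nat); exact: countableP.
Qed.

End TreeThin.

Theorem corollary3p7p1 (R : realType) (Q : choiceType) (le : Q -> Q -> Prop)
    (Q_countable_bqo : countable_bqo le) (Q_thin : countable_thin R le) :
  countable_thin R (@fset_le Q le) /\ thin R (@labeled_tree_le Q le).
Proof. by split; [exact: fset_thin|exact: labeled_tree_thin]. Qed.
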